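(* For each integer $n > 4$ there exists a $3$-graph $H$ on $n$ vertices with $\delta_2(H) = \lfloor 3n/4 \rfloor - 2$ that does not contain the square of a tight Hamilton cycle.
   Context: A $3$-graph $H$ consists of a finite vertex set $V(H)$ and a set $E(H)$ of $3$-element subsets of $V(H)$ (edges). The minimum codegree $\delta_2(H)$ is the largest $m$ such that every pair of distinct vertices of $H$ is contained in at least $m$ edges. $K_4^3$ (a tetrahedron) is the complete $3$-graph on four vertices. A $3$-graph $H$ contains the square of a tight Hamilton cycle if its vertices can be cyclically ordered so that every set of four consecutive vertices induces a copy of $K_4^3$ in $H$. *)

(* Defs.v *)
From mathcomp Require Import all_boot.
Set Implicit Arguments.
Unset Strict Implicit.
Unset Printing Implicit Defensive.

Record graph3 (V : finType) := Graph3 {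
  edges : {set {set V}};
  edges_card3 : forall e : {set V}, e \in edges -> #|e| = 3 }.

Definition codegree (V : finType) (H : graph3 V) (u v : V) : nat :=
  #|[set e in edges H | (u \in e) && (v \in e)]|.

Definition codegree_ge (V : finType) (H : graph3 V) (m : nat) : bool :=
  [forall u : V, forall v : V, (u != v) ==> (m <= codegree H u v)].

(* No codegree exceeds #|edges H|, so the range of m loses nothing as soon as
   V has two vertices (see min_codegreeP); on fewer vertices, where the
   largest m is undefined, the value is #|edges H|. *)
Definition min_codegree (V : finType) (H : graph3 V) : nat :=
  \max_(m < #|edges H|.+1 | codegree_ge H m) m.

Lemma min_codegreeP (V : finType) (H : graph3 V) (m : nat) :
  1 < #|V| -> (m <= min_codegree H) = codegree_ge H m.
Proof.
move=> /card_gt1P [a [b [_ _ neq_ab]]].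
have geW k l : k <= l -> codegree_ge H l -> codegree_ge H k.
  move=> le_kl /forallP Hl; apply/forallP=> u; apply/forallP=> v.
  apply/implyP=> neq_uv.
  by move/forallP/(_ v)/implyP/(_ neq_uv): (Hl u); apply: leq_trans.
apply/idP/idP => [le_m | Hm].
  have ge0 : codegree_ge H (@ord0 #|edges H|).
    by apply/forallP=> u; apply/forallP=> v; rewrite leq0n implybT.
  apply: geW le_m _; rewrite /min_codegree.
  by rewrite (bigmax_eq_arg (@ord0 #|edges H|)) //; case: arg_maxnP.
have lt_m : m < #|edges H|.+1.
  have /forallP/(_ a)/forallP/(_ b)/implyP/(_ neq_ab) le_m := Hm.
  rewrite ltnS; apply: leq_trans le_m _; apply: subset_leq_card.
  by apply/subsetP=> e; rewrite inE => /andP[].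
exact: (@leq_bigmax_cond _ _ (fun i : 'I_#|edges H|.+1 => i : nat) (Ordinal lt_m)).
Qed.

Definition induces_tetrahedron (V : finType) (H : graph3 V) (S : {set V}) : bool :=
  (#|S| == 4) &&
  [forall e : {set V}, (e \subset S) && (#|e| == 3) ==> (e \in edges H)].

(* The list s is read cyclically: take 4 (rot i s) lists the four consecutive
   vertices starting at position i, wrapping around the end of s. *)
Definition has_tight_hamilton_square (V : finType) (H : graph3 V) : Prop :=
  exists s : seq V,
    [/\ uniq s, (forall x : V, x \in s) &
        forall i : nat, i < size s ->
          induces_tetrahedron H [set x in take 4 (rot i s)]].

(* Main.v *)
Require Import Defs.
From mathcomp Require Import all_boot.
From mathcomp Require Import zify.

(** Colour the vertices by the Klein four-group, written as pairs of booleans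
    [(p x, q x)] under [addb], and let the edges be the triples whose colours
    do not sum to zero ([parity_graph]).

    Codegree: a pair [u, v] lies in a non-edge with [w] exactly when [w] has
    the colour of [u] plus that of [v] ([codegree_parity_graph]).  If the four
    colour classes are as equal as possible, a pair thus loses at most
    [ceil (n / 4)] of the [n - 2] other vertices, and it loses exactly that
    many when its colours are distinct, nonzero, and sum to the colour of a
    largest class.

    No square of a tight Hamilton cycle: a tetrahedron has 0 or 2 vertices of
    colour zero ([zero_in_tetrahedron]).  Three of them would form a non-edge.
    If there is exactly one, the other three vertices have nonzero colours, which are
    distinct because [0 + a + a = 0], so they are all the nonzero colours, and
    these sum to zero.  Sliding a window of four vertices by one step changes
    the number of its zero vertices by at most one, so this number is the same
    [c], 0 or 2, for all windows ([window_const]).  Every vertex lies in four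
    windows, so [4 * z = c * n] for the number [z] of vertices of colour zero
    ([window_double_count]).  Hence [z = 0] or [2 * z = n], whereas a colour
    class of the balanced colouring is nonempty and smaller than [n / 2]. *)

Set Implicit Arguments.
Unset Strict Implicit.
Unset Printing Implicit Defensive.

(** * The graph of triples with nonzero colour sum *)

Section ParityGraph.

Variables (V : finType) (p q : V -> bool).

(** The two [addb]-sums are the coordinates of the colour sum of [e]. *)
Definition parity_edges : {set {set V}} :=
  [set e : {set V} | (#|e| == 3) &&
    (\big[addb/false]_(x in e) p x || \big[addb/false]_(x in e) q x)].

Lemma parity_edges_card3 (e : {set V}) : e \in parity_edges -> #|e| = 3.
Proof. by rewrite inE => /andP[/eqP]. Qed.

Definition parity_graph : graph3 V := Graph3 parity_edges_card3.

Definition colour_class (a b : bool) : {set V} :=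
  [set w | (p w == a) && (q w == b)].

Lemma set3_seq (a b c : V) : [set a; b; c] = [set x in [:: a; b; c]].
Proof. by apply/setP=> x; rewrite !inE orbA. Qed.

Lemma parity_edgesE (a b c : V) : uniq [:: a; b; c] ->
  ([set a; b; c] \in parity_edges)
    = (p a (+) p b (+) p c || (q a (+) q b (+) q c)).
Proof.
move=> abc_uniq.
have big_abc (f : V -> bool) :
    \big[addb/false]_(x in [set a; b; c]) f x = f a (+) f b (+) f c.
  rewrite set3_seq (eq_bigl (mem [:: a; b; c])) => [|x]; last by rewrite inE.
  by rewrite -big_uniq //= !big_cons big_nil addbF addbA.
by rewrite in_set !big_abc set3_seq cardsE (card_uniqP abc_uniq).
Qed.

(** Edges through [u] and [v] correspond to their third vertices, and a third
    vertex is ruled out only by having the one colour that makes the sum zero.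
    The union need not be disjoint: the excluded class may contain [u] or [v],
    which can only raise the codegree. *)
Lemma codegree_parity_graph (u v : V) : u != v ->
  codegree parity_graph u v
    = #|~: ([set u; v] :|: colour_class (p u (+) p v) (q u (+) q v))|.
Proof.
move=> neq_uv; set W := ~: _.
have WP w : (w \in W) = [&& u != w, v != w & [set u; v; w] \in parity_edges].
  rewrite /W in_setC in_setU in_set2 in_set !negb_or ![w == _]eq_sym -andbA.
  case uw: (u == w) => //=; case vw: (v == w) => //=.
  rewrite [X in _ = X]parity_edgesE; last first.
    by rewrite /= !inE negb_or neq_uv uw vw.
  by case: (p u) (p v) (p w) (q u) (q v) (q w) => [] [] [] [] [] [].
have -> : codegree parity_graph u v = #|[set [set u; v; w] | w in W]|.
  congr #|pred_of_set _|; apply/setP=> e; rewrite in_set.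
  apply/idP/imsetP=> [/and3P[e_edge ue ve] | [w]]; last first.
    by rewrite WP => /and3P[_ _ w_edge] ->; rewrite w_edge !inE !eqxx orbT.
  have : #|e :\ u :\ v| == 1.
    have := parity_edges_card3 e_edge.
    by rewrite (cardsD1 u) ue (cardsD1 v) !inE eq_sym neq_uv ve => /eqP.
  case/cards1P=> w e_w.
  have : w \in e :\ u :\ v by rewrite e_w set11.
  rewrite !inE => /and3P[wv wu _].
  have eE : e = [set u; v; w].
    by rewrite -(setD1K ue) -(setD1K (a := v) (A := e :\ u)) ?e_w ?setUA //
               !inE eq_sym neq_uv ve.
  by exists w; rewrite // WP -eE e_edge ![_ == w]eq_sym wv wu.
apply: card_in_imset => w w'; rewrite !WP => /and3P[uw vw _] _ /setP/(_ w).
by rewrite !inE eqxx orbT ![w == _]eq_sym (negbTE uw) (negbTE vw) => /esym/eqP.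
Qed.

Definition zero_coloured : pred V := [pred x | ~~ p x & ~~ q x].

(** A statement about the colours of four vertices only: once the four triples
    are known to be edges, all 256 colourings are inspected. *)
Lemma zero_in_tetrahedron (t : seq V) :
    size t = 4 -> induces_tetrahedron parity_graph [set x in t] ->
  count zero_coloured t = 0 \/ count zero_coloured t = 2.
Proof.
case: t => [|x [|y [|z [|t []]]]] //= _ /andP[card4 /forallP tetra].
have t_uniq : uniq [:: x; y; z; t].
  by apply/card_uniqP; rewrite -cardsE (eqP card4).
have edge a b c : subseq [:: a; b; c] [:: x; y; z; t] ->
    p a (+) p b (+) p c || (q a (+) q b (+) q c).
  move=> abc; have abc_uniq := subseq_uniq abc t_uniq.
  rewrite -parity_edgesE //; apply: (implyP (tetra _)); rewrite set3_seq.
  rewrite cardsE (card_uniqP abc_uniq) andbT.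
  by apply/subsetP=> w; rewrite !in_set; apply: (mem_subseq abc).
have sub_mask m := mask_subseq m [:: x; y; z; t].
have := edge _ _ _ (sub_mask [:: false; true; true; true]).
have := edge _ _ _ (sub_mask [:: true; false; true; true]).
have := edge _ _ _ (sub_mask [:: true; true; false; true]).
have := edge _ _ _ (sub_mask [:: true; true; true; false]).
rewrite /zero_coloured /=.
by case: (p x) (p y) (p z) (p t) (q x) (q y) (q z) (q t)
  => [] [] [] [] [] [] [] [] //=; auto.
Qed.

End ParityGraph.

(** * Windows of length four in a periodic sequence *)

Definition window (b : nat -> bool) (i : nat) : nat :=
  b i + b i.+1 + b i.+2 + b i.+3.

(** Consecutive windows differ by [b i.+4 - b i], too little to pass between
    0 and 2. *)
Lemma window_const (b : nat -> bool) :
    (forall i, window b i = 0 \/ window b i = 2) ->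
  forall i, window b i = window b 0.
Proof.
move=> b02; elim=> // i <-; move: (b02 i) (b02 i.+1); rewrite /window; lia.
Qed.

Lemma sum_period_shift (n k : nat) (f : nat -> nat) :
    (forall i, f (n + i) = f i) ->
  \sum_(i < n) f (k + i) = \sum_(i < n) f i.
Proof.
move=> f_per; elim: k => // k <-.
apply/eqP; rewrite -(eqn_add2l (f k)); apply/eqP.
transitivity (\sum_(i < n.+1) f (k + i)).
  rewrite big_ord_recl /= addn0; congr addn.
  by apply: eq_bigr => i _; rewrite addnS.
by rewrite big_ord_recr /= [k + n]addnC f_per addnC.
Qed.

Lemma window_double_count (n : nat) (b : nat -> bool) :
    (forall i, b (n + i) = b i) ->
  \sum_(i < n) window b i = 4 * \sum_(i < n) b i.
Proof.
move=> b_per; rewrite !big_split /=.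
have shift k : \sum_(i < n) b (k + i) = \sum_(i < n) b i.
  by apply: (@sum_period_shift n k b) => i; rewrite b_per.
have := (shift 1, shift 2, shift 3); rewrite /= => -[[-> ->] ->]; lia.
Qed.

Lemma take_rot_nth (T : Type) (x0 : T) (s : seq T) (k i : nat) :
    k <= size s -> i < size s ->
  take k (rot i s) = [seq nth x0 s ((i + j) %% size s) | j <- iota 0 k].
Proof.
move=> le_ks lt_is; have size_k : size (take k (rot i s)) = k.
  by rewrite size_takel ?size_rot.
apply: (@eq_from_nth _ x0) => [|j]; rewrite size_k ?size_map ?size_iota // => jk.
rewrite nth_take // (nth_map 0) ?size_iota // nth_iota // add0n.
rewrite /rot nth_cat size_drop nth_drop; case: ltnP => ij.
  by rewrite modn_small //; lia.
rewrite nth_take; last by lia.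
congr nth; rewrite -[i + j](subnK (m := size s)); last by lia.
by rewrite modnDr modn_small; lia.
Qed.

(** * The obstruction to squares of tight Hamilton cycles *)

(** With the cyclic order read as a periodic sequence, the indicator of colour
    zero has all its windows in {0, 2}, so they are all equal; counting them
    doubly leaves only these two class sizes. *)
Lemma tight_hamilton_square_zero_class (V : finType) (p q : V -> bool) :
    3 < #|V| -> has_tight_hamilton_square (parity_graph p q) ->
  #|colour_class p q false false| = 0
  \/ 2 * #|colour_class p q false false| = #|V|.
Proof.
move=> V4 [s [s_uniq s_all s_tetra]]; set n := #|V|.
have size_s : size s = n.
  by rewrite -(card_uniqP s_uniq); apply: eq_card => x; rewrite s_all.
have /card_gt0P[x0 _] : 0 < #|V| by apply: leq_trans V4.
pose b i := zero_coloured p q (nth x0 s (i %% n)).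
have b_per i : b (n + i) = b i by rewrite /b modnDl.
have windowE i : window b i = count (zero_coloured p q) (take 4 (rot (i %% n) s)).
  have i_lt : i %% n < n by rewrite ltn_mod; lia.
  rewrite (take_rot_nth x0) ?size_s //.
  rewrite /= !modnDml addn0 addn1 addn2 addn3 /window /b /=; lia.
have window02 i : window b i = 0 \/ window b i = 2.
  have i_lt : i %% n < n by rewrite ltn_mod; lia.
  rewrite windowE; apply: zero_in_tetrahedron.
    by rewrite size_takel // size_rot size_s.
  by apply: s_tetra; rewrite size_s.
have zero_sum : \sum_(i < n) b i = #|colour_class p q false false|.
  rewrite -sum1_card [RHS]big_mkcond /= [RHS](eq_bigl (mem s)) => [|x]; last first.
    by rewrite /= s_all.
  rewrite -big_uniq //= (big_nth x0) size_s big_mkord; apply: eq_bigr => i _.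
  by rewrite /b modn_small // inE /zero_coloured /= !eqbF_neg; case: andP.
have := window_double_count b_per; rewrite zero_sum.
under eq_bigr do rewrite window_const //.
rewrite sum_nat_const card_ord.
by case: (window02 0) => ->; lia.
Qed.

(** * The balanced colouring *)

Lemma card_residue_le (n r : nat) :
  #|[set i : 'I_n | i %% 4 == r]| <= (n + 3) %/ 4.
Proof.
have f_lt (i : 'I_n) : i %/ 4 < (n + 3) %/ 4 by have := ltn_ord i; lia.
rewrite -[leqRHS]card_ord -(card_in_imset (f := fun i => Ordinal (f_lt i))).
  exact: max_card.
move=> i j; rewrite !inE => /eqP ir /eqP jr [ij].
by apply: val_inj; rewrite /= (divn_eq i 4) (divn_eq j 4) ij ir jr.
Qed.

Lemma card_residue0 (n : nat) :
  #|[set i : 'I_n | i %% 4 == 0]| = (n + 3) %/ 4.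
Proof.
apply/eqP; rewrite eqn_leq card_residue_le /=.
have f_lt (j : 'I_((n + 3) %/ 4)) : 4 * j < n by have := ltn_ord j; lia.
rewrite -[leqLHS]card_ord -(card_imset (f := fun j => Ordinal (f_lt j))).
  apply/subset_leq_card/subsetP=> _ /imsetP[j _ ->].
  by rewrite inE /= modnMr.
by move=> i j [] /eqP; rewrite eqn_mul2l => /eqP; apply: val_inj.
Qed.

(** Reading off the two low bits makes the colour of [i] a function of
    [i %% 4].  They are negated so that the residue 0, whose class is a
    largest one, gets a nonzero colour, and colour zero goes to residue 3. *)
Definition bit0 (n : nat) (i : 'I_n) : bool := ~~ odd i.
Definition bit1 (n : nat) (i : 'I_n) : bool := ~~ odd i./2.

Lemma colour_class_residue (n : nat) (a b : bool) :
  colour_class (@bit0 n) (@bit1 n) a b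
    = [set i : 'I_n | i %% 4 == ~~ a + 2 * ~~ b].
Proof.
by apply/setP=> i; rewrite !inE /bit0 /bit1; case: a b => [] []; lia.
Qed.

(** The minimum is attained at the vertices 1 and 2, whose colours sum to that
    of residue 0, and which are not in that class themselves. *)
Lemma min_codegree_balanced (n : nat) : 4 < n ->
  min_codegree (parity_graph (@bit0 n) (@bit1 n)) = (3 * n) %/ 4 - 2.
Proof.
move=> n4; set H := parity_graph _ _.
have V2 : 1 < #|'I_n| by rewrite card_ord; lia.
apply/eqP; rewrite eqn_leq; apply/andP; split.
  have lt1 : 1 < n by lia.
  have lt2 : 2 < n by lia.
  pose u := Ordinal lt1; pose v := Ordinal lt2.
  have : codegree_ge H (min_codegree H) by rewrite -min_codegreeP.
  move=> /forallP/(_ u)/forallP/(_ v)/implyP/(_ isT)/leq_trans; apply.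
  rewrite codegree_parity_graph // cardsCs setCK card_ord cardsU.
  rewrite colour_class_residue card_residue0 cards2 /=.
  have -> : [set u; v] :&: [set i : 'I_n | i %% 4 == 0] = set0.
    by apply/setP=> i; rewrite !inE; case: eqP => [->|_] //=; case: eqP => [->|].
  by rewrite cards0; lia.
rewrite min_codegreeP //; apply/forallP=> u; apply/forallP=> v.
apply/implyP=> neq_uv; rewrite codegree_parity_graph // cardsCs setCK card_ord.
rewrite colour_class_residue cardsU cards2 neq_uv.
set r := ~~ _ + 2 * _; have := card_residue_le n r; lia.
Qed.

Theorem proposition1p3 (n : nat) (hn : 4 < n) :
  exists (V : finType) (H : graph3 V),
    [/\ #|V| = n,
        min_codegree H = (3 * n) %/ 4 - 2 &
        ~ has_tight_hamilton_square H].
Proof.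
exists 'I_n, (parity_graph (@bit0 n) (@bit1 n)); split.
- exact: card_ord.
- exact: min_codegree_balanced.
move=> /tight_hamilton_square_zero_class; rewrite card_ord colour_class_residue.
move=> /(_ (ltnW hn)) [/eqP | half].
  have lt3 : 3 < n by lia.
  by rewrite cards_eq0 => /eqP/setP/(_ (Ordinal lt3)); rewrite !inE.
(* A class of size n / 2 is impossible because ceil (n / 4) < n / 2. *)
have := leq_mul (leqnn 2) (card_residue_le n (~~ false + 2 * ~~ false)).
by rewrite half; lia.
Qed.
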